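(* Let $G=\langle g_1,\ldots,g_n \mid g_i^2=1,\ i=1,\ldots,n\rangle$ (i.e. $G$ is a free Coxeter group). Then the Hurwitz action of the braid group $B_n$ on $(g_1,\ldots,g_n)$ is transitive; that is, for every permutation $\tau$ of $\{1,\ldots,n\}$ and all $f_1,\ldots,f_n\in G$ such that $g_{\tau(1)}^{f_1}\cdots g_{\tau(n)}^{f_n}=g_1\cdots g_n$, the tuple $(g_{\tau(1)}^{f_1},\ldots,g_{\tau(n)}^{f_n})$ lies in the $B_n$-orbit of $(g_1,\ldots,g_n)$.
   Context: Notation: $g^h=hgh^{-1}$ for elements $g,h$ of a group. Braid group: $B_n$ is the group with generators $\sigma_1,\ldots,\sigma_{n-1}$ and relations $\sigma_i\sigma_{i+1}\sigma_i=\sigma_{i+1}\sigma_i\sigma_{i+1}$ for $1\le i\le n-2$, and $\sigma_i\sigma_j=\sigma_j\sigma_i$ for $|i-j|>1$. Hurwitz action of $B_n$ on $n$-tuples of elements of a group $G$: $$\sigma_i(h_1,\ldots,h_n)=(h_1,\ldots,h_{i-1},h_{i+1}^{h_i},h_i,h_{i+2},\ldots,h_n),$$ $$\sigma_i^{-1}(h_1,\ldots,h_n)=(h_1,\ldots,h_{i-1},h_{i+1},h_i^{h_{i+1}^{-1}},h_{i+2},\ldots,h_n).$$ *)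

(* Defs.v *)
From HB Require Import structures.
From mathcomp Require Import all_boot monoid perm.
From mathcomp Require Import boolp.

Set Implicit Arguments.
Unset Strict Implicit.
Unset Printing Implicit Defensive.

Local Open Scope group_scope.
Local Open Scope quotient_scope.

(* The letter (x, false) stands for x and (x, true) for x^-1. *)
Definition word (X : Type) := seq (X * bool).

Definition letter_inv (X : Type) (l : X * bool) : X * bool := (l.1, ~~ l.2).
Definition word_inv (X : Type) (w : word X) : word X := rev (map (@letter_inv X) w).

(* Defining relations u = v, given as the set of pairs (u, v). *)
Definition relations (X : Type) := word X -> word X -> Prop.

(* The congruence on words whose quotient is the group < X | R >. *)
Inductive pres_eq (X : Type) (R : relations X) : word X -> word X -> Prop :=
| pres_refl u : pres_eq R u u
| pres_sym u v : pres_eq R u v -> pres_eq R v u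
| pres_trans u v w : pres_eq R u v -> pres_eq R v w -> pres_eq R u w
| pres_cat u u' v v' :
    pres_eq R u u' -> pres_eq R v v' -> pres_eq R (u ++ v) (u' ++ v')
| pres_cancel l : pres_eq R [:: l; letter_inv l] [::]
| pres_rel u v : R u v -> pres_eq R u v.

Definition pres_eqb (X : choiceType) (R : relations X) : rel (word X) :=
  fun u v => `[< pres_eq R u v >].

Lemma pres_eqb_equiv (X : choiceType) (R : relations X) :
  equiv_class_of (pres_eqb R).
Proof.
split=> [u|u v|v u w]; first exact/asboolP/pres_refl.
- by apply/asboolP/asboolP => /pres_sym.
- by move=> /asboolP uv /asboolP vw; apply/asboolP; apply: pres_trans uv vw.
Qed.

Canonical pres_equiv_rel (X : choiceType) (R : relations X) :=
  EquivRelPack (pres_eqb_equiv R).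

Definition presented (X : choiceType) (R : relations X) : Type :=
  {eq_quot (pres_equiv_rel R)}.

HB.instance Definition _ (X : choiceType) (R : relations X) :=
  Choice.on (presented R).
HB.instance Definition _ (X : choiceType) (R : relations X) :=
  EqQuotient.on (presented R).

Section PresentedGroup.
Variables (X : choiceType) (R : relations X).
Local Notation G := (presented R).
Implicit Types (u v w : word X) (a b c : G).

Definition pres_class (w : word X) : G := \pi w.

Lemma pres_classP u v : pres_class u = pres_class v <-> pres_eq R u v.
Proof.
split=> [/eqquotP uv | uv]; first by apply/asboolP; exact: uv.
by apply/eqquotP; apply/asboolP.
Qed.

Lemma pres_class_repr a : pres_class (repr a) = a.
Proof. exact: reprK. Qed.

Lemma pres_eq_repr w : pres_eq R (repr (pres_class w)) w.
Proof. by apply/pres_classP; rewrite pres_class_repr. Qed.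

Lemma word_invK : involutive (@word_inv X).
Proof.
move=> w; rewrite /word_inv map_rev revK -map_comp -[RHS]map_id.
by apply: eq_map => -[x s]; rewrite /= /letter_inv /= negbK.
Qed.

Lemma word_inv_cat u v : word_inv (u ++ v) = word_inv v ++ word_inv u.
Proof. by rewrite /word_inv map_cat rev_cat. Qed.

Lemma pres_catV w : pres_eq R (w ++ word_inv w) [::].
Proof.
elim: w => [|l w IHw]; first exact: pres_refl.
rewrite -[l :: w]cat1s word_inv_cat -catA (catA w).
apply: pres_trans (pres_cancel R l).
have -> : [:: l; letter_inv l] = [:: l] ++ ([::] ++ word_inv [:: l]) by [].
apply: pres_cat; first exact: pres_refl.
by apply: pres_cat => //; exact: pres_refl.
Qed.

Lemma pres_inv u v : pres_eq R u v -> pres_eq R (word_inv u) (word_inv v).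
Proof.
move=> uv; have refl := @pres_refl X R.
apply: (@pres_trans _ _ _ (word_inv u ++ (v ++ word_inv v))).
  rewrite -{1}[word_inv u]cats0; apply: pres_cat => //.
  exact/pres_sym/pres_catV.
rewrite catA -{2}[word_inv v]cat0s; apply: pres_cat => //.
apply: pres_trans (_ : pres_eq R (word_inv u ++ u) _).
  by apply: pres_cat => //; exact: pres_sym.
by rewrite -{2}[u]word_invK; exact: pres_catV.
Qed.

Definition pres_one : G := pres_class [::].
Definition pres_mul a b : G := pres_class (repr a ++ repr b).
Definition pres_invg a : G := pres_class (word_inv (repr a)).

Lemma pres_mulE u v :
  pres_mul (pres_class u) (pres_class v) = pres_class (u ++ v).
Proof. by apply/pres_classP/pres_cat; exact: pres_eq_repr. Qed.

Lemma pres_mulA : associative pres_mul.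
Proof.
move=> a b c; rewrite -[a]pres_class_repr -[b]pres_class_repr.
by rewrite -[c]pres_class_repr !pres_mulE catA.
Qed.

Lemma pres_mul1 : left_id pres_one pres_mul.
Proof. by move=> a; rewrite -[a]pres_class_repr pres_mulE. Qed.

Lemma pres_mulr1 : right_id pres_one pres_mul.
Proof. by move=> a; rewrite -[a]pres_class_repr pres_mulE cats0. Qed.

Lemma pres_mulV : left_inverse pres_one pres_invg pres_mul.
Proof.
move=> a; rewrite -{2}[a]pres_class_repr pres_mulE.
by apply/pres_classP; rewrite -{2}[repr a]word_invK; exact: pres_catV.
Qed.

Lemma pres_mulrV : right_inverse pres_one pres_invg pres_mul.
Proof.
move=> a; rewrite -{1}[a]pres_class_repr pres_mulE.
by apply/pres_classP; exact: pres_catV.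
Qed.

HB.instance Definition _ :=
  isGroup.Build G pres_mulA pres_mul1 pres_mulr1 pres_mulV pres_mulrV.

Definition pres_gen (x : X) : G := pres_class [:: (x, false)].

Lemma pres_classM u v : pres_class (u ++ v) = pres_class u * pres_class v.
Proof. exact/esym/pres_mulE. Qed.

Lemma pres_class_nil : pres_class [::] = 1. Proof. by []. Qed.

Lemma pres_classV u : pres_class (word_inv u) = (pres_class u)^-1.
Proof. exact/pres_classP/pres_inv/pres_sym/pres_eq_repr. Qed.

Lemma pres_class_word w :
  pres_class w =
  \prod_(l <- w) (if l.2 then (pres_gen l.1)^-1 else pres_gen l.1).
Proof.
elim: w => [|[x s] w IHw]; first by rewrite big_nil.
rewrite big_cons -IHw -cat1s pres_classM; congr (_ * _).
by case: s => //=; rewrite -pres_classV.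
Qed.

Lemma pres_class_rel u v : R u v -> pres_class u = pres_class v.
Proof. by move=> uv; apply/pres_classP/pres_rel. Qed.

End PresentedGroup.

(* An action of < X | R > on T is determined by permutations op x of T, with
   inverses opV x, that satisfy the relations. *)
Section PresentedAction.
Variables (X : choiceType) (R : relations X) (T : Type).
Variables op opV : X -> T -> T.

Definition letter_act (l : X * bool) : T -> T :=
  if l.2 then opV l.1 else op l.1.

Definition word_act (w : word X) (t : T) : T := foldr letter_act t w.

Definition pres_act (a : presented R) (t : T) : T := word_act (repr a) t.

Hypothesis opK : forall x, cancel (op x) (opV x).
Hypothesis opVK : forall x, cancel (opV x) (op x).
Hypothesis op_rel : forall u v, R u v -> word_act u =1 word_act v.

Lemma word_act_eq u v : pres_eq R u v -> word_act u =1 word_act v.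
Proof.
elim=> {u v} // [u v _ IH t|u v w _ IH1 _ IH2 t|u u' v v' _ IH1 _ IH2 t|[x s] t].
- by rewrite IH.
- by rewrite IH1.
- by rewrite /word_act !foldr_cat -!/(word_act _ _) IH2 IH1.
- by case: s; rewrite /= /letter_act /= ?opK ?opVK.
Qed.

Lemma pres_act_class w t : pres_act (pres_class R w) t = word_act w t.
Proof. exact/word_act_eq/pres_eq_repr. Qed.

Lemma pres_act1 t : pres_act 1 t = t.
Proof. exact: (pres_act_class [::]). Qed.

Lemma pres_actM a b t : pres_act (a * b) t = pres_act a (pres_act b t).
Proof.
rewrite -[a]pres_class_repr -[b]pres_class_repr -pres_classM.
by rewrite !pres_act_class /word_act foldr_cat.
Qed.

Lemma pres_act_gen x t : pres_act (pres_gen R x) t = op x t.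
Proof. exact: pres_act_class. Qed.

Lemma pres_act_genV x t : pres_act (pres_gen R x)^-1 t = opV x t.
Proof. by rewrite -pres_classV pres_act_class. Qed.

End PresentedAction.

Inductive coxeter_rel (n : nat) : relations 'I_n :=
| CoxeterRel i : coxeter_rel [:: (i, false); (i, false)] [::].

Definition free_coxeter (n : nat) := presented (@coxeter_rel n).
HB.instance Definition _ (n : nat) := Group.on (free_coxeter n).

Definition cox_gen (n : nat) (i : 'I_n) : free_coxeter n :=
  pres_gen (@coxeter_rel n) i.

Lemma cox_gen_sqr (n : nat) (i : 'I_n) : cox_gen i ^+ 2 = 1.
Proof.
rewrite expgS expg1 -pres_classM; exact/(pres_class_rel (CoxeterRel i)).
Qed.

(* Indices are shifted to start at 0. *)
Inductive braid_rel (n : nat) : relations 'I_n.-1 :=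
| BraidRel (i j : 'I_n.-1) of j = i.+1 :> nat :
    braid_rel [:: (i, false); (j, false); (i, false)]
              [:: (j, false); (i, false); (j, false)]
| BraidComm (i j : 'I_n.-1) of (i.+1 < j) || (j.+1 < i) :
    braid_rel [:: (i, false); (j, false)] [:: (j, false); (i, false)].

Definition braid (n : nat) := presented (@braid_rel n).
HB.instance Definition _ (n : nat) := Group.on (braid n).

Definition braid_gen (n : nat) (i : 'I_n.-1) : braid n :=
  pres_gen (@braid_rel n) i.

Lemma braid_genB (n : nat) (i j : 'I_n.-1) : j = i.+1 :> nat ->
  braid_gen i * braid_gen j * braid_gen i =
  braid_gen j * braid_gen i * braid_gen j.
Proof.
move=> /BraidRel/pres_class_rel; rewrite !pres_class_word !big_cons !big_nil /=.
by rewrite !mulg1 !mulgA.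
Qed.

Lemma braid_genC (n : nat) (i j : 'I_n.-1) : (i.+1 < j) || (j.+1 < i) ->
  braid_gen i * braid_gen j = braid_gen j * braid_gen i.
Proof.
move=> /BraidComm/pres_class_rel; rewrite !pres_class_word !big_cons !big_nil /=.
by rewrite !mulg1.
Qed.

(* g^h = h g h^-1, whereas the library's g ^ h is h^-1 g h. *)
Definition lconj (G : groupType) (g h : G) : G := h * g * h^-1.

Section Hurwitz.
Variables (G : groupType) (n : nat).
Implicit Types (i j : 'I_n.-1) (h : n.-tuple G) (b : braid n).

Lemma hurwitz_pos_subproof i : i < n.
Proof. exact: leq_trans (ltn_ord i) (leq_pred n). Qed.
Lemma hurwitz_posS_subproof i : i.+1 < n.
Proof. by rewrite -ltn_predRL. Qed.

Definition hurwitz_pos i : 'I_n := Ordinal (hurwitz_pos_subproof i).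
Definition hurwitz_posS i : 'I_n := Ordinal (hurwitz_posS_subproof i).

Definition hurwitz_sigma i h : n.-tuple G :=
  let x := tnth h (hurwitz_pos i) in
  let y := tnth h (hurwitz_posS i) in
  [tuple if k == hurwitz_pos i then lconj y x
         else if k == hurwitz_posS i then x
         else tnth h k | k < n].

Definition hurwitz_sigmaV i h : n.-tuple G :=
  let x := tnth h (hurwitz_pos i) in
  let y := tnth h (hurwitz_posS i) in
  [tuple if k == hurwitz_pos i then y
         else if k == hurwitz_posS i then lconj x y^-1
         else tnth h k | k < n].

(* Well defined by hurwitz_sigma_rel below. *)
Definition hurwitz_act b h : n.-tuple G :=
  pres_act hurwitz_sigma hurwitz_sigmaV b h.

Lemma hurwitz_posS_neq i : (hurwitz_posS i == hurwitz_pos i) = false.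
Proof. by rewrite -val_eqE /= gtn_eqF. Qed.

Lemma hurwitz_sigmaK i : cancel (hurwitz_sigma i) (hurwitz_sigmaV i).
Proof.
move=> h; apply: eq_from_tnth => k.
rewrite !tnth_mktuple !eqxx hurwitz_posS_neq /lconj.
case: eqP => [->//|_]; case: eqP => [->|//].
by rewrite invgK !mulgA mulVg mul1g mulgVK.
Qed.

Lemma hurwitz_sigmaVK i : cancel (hurwitz_sigmaV i) (hurwitz_sigma i).
Proof.
move=> h; apply: eq_from_tnth => k.
rewrite !tnth_mktuple !eqxx hurwitz_posS_neq /lconj.
case: eqP => [->|_]; last by case: eqP => [->|].
by rewrite invgK !mulgA mulgV mul1g mulgK.
Qed.

Lemma hurwitz_sigma_rel u v : braid_rel u v ->
  word_act hurwitz_sigma hurwitz_sigmaV u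
    =1 word_act hurwitz_sigma hurwitz_sigmaV v.
Proof.
case=> {u v} [i j ji|i j ij] h; apply: eq_from_tnth => k.
- rewrite /word_act /= /letter_act /=.
  have ij : hurwitz_pos j = hurwitz_posS i by apply: val_inj.
  have d1 : (hurwitz_posS i == hurwitz_pos i) = false by exact: hurwitz_posS_neq.
  have d2 : (hurwitz_posS j == hurwitz_pos i) = false.
    by rewrite -val_eqE /= ji gtn_eqF // leqW.
  have d3 : (hurwitz_posS j == hurwitz_posS i) = false.
    by rewrite -val_eqE /= ji gtn_eqF.
  have d1' : (hurwitz_pos i == hurwitz_posS i) = false by rewrite eq_sym.
  have d2' : (hurwitz_pos i == hurwitz_posS j) = false by rewrite eq_sym.
  have d3' : (hurwitz_posS i == hurwitz_posS j) = false by rewrite eq_sym.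
  do !rewrite !tnth_mktuple ?ij ?eqxx ?d1 ?d2 ?d3 ?d1' ?d2' ?d3'.
  case: (k =P hurwitz_pos i) => [->|_]; rewrite ?d1' ?d2' ?d1.
    by rewrite /lconj !invgM !invgK !mulgA ?mulgVK.
  by case: (k =P hurwitz_posS i) => // _; case: eqP.
- rewrite /word_act /= /letter_act /=.
  have d1 : (hurwitz_pos i == hurwitz_pos j) = false.
    rewrite -val_eqE /=; case/orP: ij => ?.
      by rewrite ltn_eqF // ltnW.
    by rewrite gtn_eqF // ltnW.
  have d2 : (hurwitz_posS i == hurwitz_pos j) = false.
    rewrite -val_eqE /=; case/orP: ij => ?; [by rewrite ltn_eqF|].
    by rewrite gtn_eqF // ltnS ltnW // ltnW.
  have d3 : (hurwitz_pos i == hurwitz_posS j) = false.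
    rewrite -val_eqE /=; case/orP: ij => ?; [|by rewrite gtn_eqF].
    by rewrite ltn_eqF // ltnS ltnW // ltnW.
  have d4 : (hurwitz_posS i == hurwitz_posS j) = false.
    by rewrite -val_eqE /= eqSS; exact: d1.
  have d1' : (hurwitz_pos j == hurwitz_pos i) = false by rewrite eq_sym.
  have d2' : (hurwitz_pos j == hurwitz_posS i) = false by rewrite eq_sym.
  have d3' : (hurwitz_posS j == hurwitz_pos i) = false by rewrite eq_sym.
  have d4' : (hurwitz_posS j == hurwitz_posS i) = false by rewrite eq_sym.
  do !rewrite !tnth_mktuple ?eqxx ?d1 ?d2 ?d3 ?d4 ?d1' ?d2' ?d3' ?d4'.
  case: (k =P hurwitz_pos i) => [->|_]; first by rewrite d1 d3.
  by case: (k =P hurwitz_posS i) => [->|_]; rewrite ?d2 ?d4.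
Qed.

Lemma hurwitz_act1 h : hurwitz_act 1 h = h.
Proof.
exact: (pres_act1 hurwitz_sigmaK hurwitz_sigmaVK hurwitz_sigma_rel).
Qed.

Lemma hurwitz_actM a b h :
  hurwitz_act (a * b) h = hurwitz_act a (hurwitz_act b h).
Proof.
exact: (pres_actM hurwitz_sigmaK hurwitz_sigmaVK hurwitz_sigma_rel).
Qed.

Lemma hurwitz_act_gen i h : hurwitz_act (braid_gen i) h = hurwitz_sigma i h.
Proof.
exact: (pres_act_gen hurwitz_sigmaK hurwitz_sigmaVK hurwitz_sigma_rel).
Qed.

Lemma hurwitz_act_genV i h :
  hurwitz_act (braid_gen i)^-1 h = hurwitz_sigmaV i h.
Proof.
exact: (pres_act_genV hurwitz_sigmaK hurwitz_sigmaVK hurwitz_sigma_rel).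
Qed.

Definition hurwitz_orbit h : n.-tuple G -> Prop :=
  fun h' => exists b : braid n, h' = hurwitz_act b h.

End Hurwitz.

(* Main.v *)
Require Import Defs.
From mathcomp Require Import all_boot monoid perm.

(** The proof is a descent on the total length of the conjugating words.

    Every element of the free Coxeter group W is the product of a word in the
    generators, and a reduced word (no two adjacent letters equal) is determined
    by its product (wprod_inj).  A conjugate of a generator is therefore coded
    by a pair (u, a) standing for the palindrome u a u^-1 (refl), and a
    factorization of c = g_1 ... g_n by a list of such pairs, whose centers a
    are pairwise distinct because tau is a permutation.  If some u a is not
    reduced, u can be shortened (refl_shorten).  If the word u a of one factor
    is a prefix of the word v b of a neighbouring one, then a <> b makes it a
    prefix of v, and the Hurwitz move that conjugates the second factor by the
    first turns v = u a v' into u v' (refl_conj), so the total length drops.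

    In the remaining case consecutive words u a and v b diverge after a common
    part.  In the product of two neighbouring factors only that common part
    cancels, so all the centers survive and the product has an explicit reduced
    form (separated_prod).  Its length exceeds n unless all the words u are
    empty; but c has the reduced word g_1 ... g_n of length n.  So the factors
    are generators, and uniqueness of reduced words says that they are
    g_1, ..., g_n in this order (separated_standard). *)

Local Open Scope group_scope.

Set Implicit Arguments.
Unset Strict Implicit.
Unset Printing Implicit Defensive.


(** * Words *)

Lemma not_sorted_split (T : Type) (e : rel T) (s : seq T) : ~~ sorted e s ->
  exists A x y B, s = A ++ x :: y :: B /\ ~~ e x y.
Proof.
elim: s => // x [//|y s] IHs; rewrite [sorted _ _]/=.
have [exy /= | nexy _] := boolP (e x y); last by exists [::], x, y, s.
by case/IHs=> A [z [t [B [-> nezt]]]]; exists (x :: A), z, t, B.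
Qed.

Lemma prefix_split (T : eqType) (s t : seq T) :
    ~~ prefix s t -> ~~ prefix t s ->
  exists w x y X Y, [/\ s = w ++ x :: X, t = w ++ y :: Y & x != y].
Proof.
elim: s t => [|x s IHs] [|y t] //=.
have [->|neq_xy _ _] := eqVneq x y; last by exists [::], x, y, s, t.
move=> nst nts; have [w [a [b [A [B [-> -> ab]]]]]] := IHs t nst nts.
by exists (y :: w), a, b, A, B.
Qed.

Section ReducedWords.
Variable T : eqType.
Implicit Types (x y : T) (s : seq T).

Definition reduced s := sorted [rel x y | x != y] s.

(** Left multiplication by a generator, on reduced words. *)
Definition push x s :=
  if s is y :: s' then if x == y then s' else x :: s else [:: x].

Lemma push_reduced x s : reduced s -> reduced (push x s).
Proof.
case: s => //= y s red_s; case: eqVneq => [_|neq_xy /=].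
  exact: path_sorted red_s.
by rewrite neq_xy.
Qed.

Lemma pushK x s : reduced s -> push x (push x s) = s.
Proof.
case: s => [|y s] /=; first by rewrite eqxx.
case: (eqVneq x y) => [<-|_ _]; last by rewrite /= eqxx.
by case: s => //= z s /andP[/negPf->].
Qed.

Lemma foldr_push s : reduced s -> foldr push [::] s = s.
Proof.
elim: s => //= x s IHs red_xs; rewrite IHs; last exact: path_sorted red_xs.
by case: s red_xs {IHs} => //= y s /andP[/negPf->].
Qed.

(** Reducedness is built into the type because push is an involution on
    reduced words only: on x :: x :: s it is not. *)
Definition redword := {s : seq T | reduced s}.

Definition rpush x (s : redword) : redword :=
  exist _ (push x (val s)) (push_reduced x (valP s)).

Lemma rpushK x : cancel (rpush x) (rpush x).
Proof. by move=> s; apply: val_inj; rewrite /= pushK ?(valP s). Qed.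

Lemma reduced_rev s : reduced (rev s) = reduced s.
Proof.
by rewrite /reduced rev_sorted; apply: eq_sorted => x y /=; rewrite eq_sym.
Qed.

Lemma reduced_overlap s1 x s2 :
  reduced (s1 ++ x :: s2) = reduced (rcons s1 x) && reduced (x :: s2).
Proof. by case: s1 => [|z s1] //=; rewrite cat_path rcons_path /= andbA. Qed.

End ReducedWords.

Lemma uniq_reduced (T : eqType) (s : seq T) : uniq s -> reduced s.
Proof. by rewrite uniq_pairwise; exact: pairwise_sorted. Qed.

(** * Words and palindromes in the free Coxeter group *)

Section FreeCoxeter.
Variable n : nat.
Local Notation W := (free_coxeter n).
Implicit Types (s u : seq 'I_n) (p q : seq 'I_n * 'I_n).

Definition wprod s : W := \prod_(x <- s) cox_gen x.

Lemma wprod_cat s t : wprod (s ++ t) = wprod s * wprod t.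
Proof. exact: big_cat. Qed.

Lemma wprod_cons x s : wprod (x :: s) = cox_gen x * wprod s.
Proof. exact: big_cons. Qed.

Lemma wprod_rcons s x : wprod (rcons s x) = wprod s * cox_gen x.
Proof. by rewrite -cats1 wprod_cat [wprod [:: x]]big_seq1. Qed.

Lemma cox_genK (x : 'I_n) : cox_gen x * cox_gen x = 1.
Proof. by rewrite -expg2 cox_gen_sqr. Qed.

Lemma cox_genV (x : 'I_n) : (cox_gen x)^-1 = cox_gen x.
Proof. by apply: (mulgI (cox_gen x)); rewrite mulgV cox_genK. Qed.

Lemma wprod_rev s : wprod (rev s) = (wprod s)^-1.
Proof.
elim: s => [|x s IHs]; first by rewrite /wprod big_nil invg1.
by rewrite rev_cons wprod_rcons IHs wprod_cons invgM cox_genV.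
Qed.

Lemma wprod_surj (g : W) : exists s, g = wprod s.
Proof.
exists [seq l.1 | l <- repr g]; rewrite -{1}[g]pres_class_repr pres_class_word.
rewrite /wprod big_map; apply: eq_bigr => -[x []] _ //=.
exact: cox_genV.
Qed.

(** The generators act on reduced words by push, an action of W since push is
    involutive; the product of a reduced word s sends the empty word to s, so
    that s can be recovered from its product. *)
Lemma wprod_inj s t : reduced s -> reduced t -> wprod s = wprod t -> s = t.
Proof.
have wordE s' :
    wprod s' = pres_class (@coxeter_rel n) [seq (x, false) | x <- s'].
  by rewrite pres_class_word big_map.
pose act := word_act (@rpush 'I_n) (@rpush 'I_n).
have actE s' : reduced s' ->
    val (act [seq (x, false) | x <- s'] (exist _ [::] isT)) = s'.
  move=> red_s'; rewrite -[RHS]foldr_push // {red_s'}.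
  by elim: s' => //= x s' <-.
move=> red_s red_t; rewrite !wordE => /pres_classP eq_st.
rewrite -(actE s red_s) -(actE t red_t); congr val.
apply: (word_act_eq (R := @coxeter_rel n)) eq_st _ => [x|x|_ _ [x] r];
  exact: rpushK.
Qed.

(** The first half of the palindrome u a u^-1, its center included. *)
Definition center_word p := rcons p.1 p.2.

Definition refl p : W := lconj (cox_gen p.2) (wprod p.1).

Lemma reflE p : refl p = wprod (center_word p ++ rev p.1).
Proof. by rewrite wprod_cat wprod_rcons wprod_rev. Qed.

(** Two equal adjacent letters of u a either both lie in u and cancel, or are
    the last letter of u and a itself; in the latter case u = A a, and
    A a a a^-1 A^-1 = A a A^-1. *)
Lemma refl_shorten p : ~~ reduced (center_word p) ->
  exists2 u, refl p = refl (u, p.2) & size u < size p.1.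
Proof.
case: p => u a /not_sorted_split[A [x [y [B [/= eq_ua]]]]].
rewrite negbK => /eqP eq_xy; move: eq_ua; rewrite /center_word -{y}eq_xy /=.
case/lastP: B => [|B b].
  rewrite -[[:: x; x]]/(rcons [:: x] x) -rcons_cat => /rcons_inj[-> ->].
  exists A; last by rewrite size_cat addn1.
  rewrite /refl /lconj /= cats1 wprod_rcons invgM cox_genV -!mulgA.
  by rewrite (mulgA (cox_gen x) (cox_gen x)) cox_genK mul1g.
rewrite -!rcons_cons -rcons_cat => /rcons_inj[-> ->].
exists (A ++ B); last by rewrite !size_cat /= ltn_add2l leqW.
rewrite /refl /= !wprod_cat !wprod_cons.
by rewrite [cox_gen x * (_ * _)]mulgA cox_genK mul1g.
Qed.

(** The palindrome u a u^-1 turns the word u a v into u v: the conjugation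
    shortens a factor whose word swallows the center of its neighbour. *)
Lemma refl_conj p q v : q.1 = center_word p ++ v ->
  lconj (refl q) (refl p) = refl (p.1 ++ v, q.2).
Proof.
rewrite /refl /= => ->; rewrite /lconj !wprod_cat wprod_rcons.
rewrite !invgM !invgK cox_genV !mulgA.
do !rewrite ?mulgVK ?mulgK -?(mulgA _ (cox_gen _) (cox_gen _)) ?cox_genK ?mulg1.
by [].
Qed.

Lemma lconj_mul (G : groupType) (x y : G) : lconj y x * x = x * y.
Proof. exact: mulgVK. Qed.

Lemma lconj_reflK g p : lconj (lconj g (refl p)) (refl p) = g.
Proof.
have reflK : refl p * refl p = 1.
  by rewrite /refl /lconj !mulgA mulgVK -(mulgA (wprod _)) cox_genK mulg1 mulgV.
have reflV : (refl p)^-1 = refl p by apply: (mulgI (refl p)); rewrite mulgV.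
rewrite /lconj reflV; move: (refl p) reflK => x xK.
by rewrite !mulgA xK mul1g -mulgA xK mulg1.
Qed.

(** No Hurwitz move at two adjacent factors p and q with distinct centers
    shortens them; prefix_center reads a failure of this as a shortening. *)
Definition separated p q :=
  ~~ prefix (center_word p) (center_word q) &&
  ~~ prefix (center_word q) (center_word p).

Lemma prefix_center p q : p.2 != q.2 ->
  prefix (center_word p) (center_word q) ->
  exists v, q.1 = center_word p ++ v.
Proof.
move=> neq_a /prefixP[v]; case/lastP: v => [|v x].
  by rewrite cats0 => /rcons_inj[_ eq_a]; rewrite eq_a eqxx in neq_a.
by rewrite -rcons_cat => /rcons_inj[-> _]; exists v.
Qed.

(** The first half of the first palindrome survives in the product, which
    keeps the induction going.  Let w be the longest common prefix of the words
    u a = w x X = w Z a and v b = w y Y of the first two factors.  If the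
    product of the remaining factors is the reduced word w y Y r, then u^-1
    cancels exactly w, and the new product is u a followed by Z^-1 y Y r: it is
    reduced, since Z a reversed ends with x, and x <> y.  The word y Y r is
    longer than r because it contains the center b, which gives the length
    bound; equality forces Z and Y to be empty all along, that is u = v for all
    neighbours, and the last factor u a u^-1 forces u to be empty. *)
Lemma separated_prod p (L : seq (seq 'I_n * 'I_n)) :
    all (fun q => reduced (center_word q)) (p :: L) -> path separated p L ->
  exists r, [/\ \prod_(q <- p :: L) refl q = wprod (center_word p ++ r),
    reduced (center_word p ++ r), size L <= size r
    & size r = size L -> all (fun q => nilp q.1) (p :: L)].
Proof.
elim: L p => [|q L IHL] [u a].
  rewrite /= andbT /center_word /= => red_p _; exists (rev u).
  rewrite big_seq1 reflE size_rev; split=> //; last by move=> /size0nil->.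
  by rewrite cat_rcons reduced_overlap red_p -rev_rcons reduced_rev.
rewrite [all _ _]/= [path _ _ _]/=.
case/andP=> red_p red_qL /andP[/andP[sep1 sep2] sep_L].
have [r [prod_r red_r le_r tight_r]] := IHL q red_qL sep_L.
have [w [x [y [X [Y [eq_p eq_q neq_xy]]]]]] := prefix_split sep1 sep2.
(* The divergence x occurs in u, or else is the center a; Z is empty then. *)
have [Z eq_u eq_X] : exists2 Z, u = w ++ Z & x :: X = rcons Z a.
  move: eq_p; rewrite /center_word /=; case/lastP: X => [|X b].
    by rewrite cats1 => /rcons_inj[-> ->]; exists [::]; rewrite ?cats0.
  by rewrite -rcons_cons -rcons_cat => /rcons_inj[-> ->]; exists (x :: X).
exists (rev Z ++ y :: Y ++ r); split.
- rewrite big_cons prod_r reflE eq_q -!wprod_cat -!catA wprod_cat /= eq_u.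
  rewrite rev_cat !wprod_cat; congr (_ * _); rewrite -!mulgA; congr (_ * _).
  by rewrite wprod_rev !mulgA mulVg mul1g wprod_cons wprod_cat mulgA.
- have glue : a :: rev Z ++ y :: Y ++ r = rev X ++ x :: y :: Y ++ r.
    by rewrite -(cat_cons a) -(rev_rcons Z) -eq_X rev_cons cat_rcons.
  rewrite /center_word cat_rcons reduced_overlap red_p glue.
  rewrite reduced_overlap -rev_cons reduced_rev.
  move: red_p red_r; rewrite eq_p eq_q -catA !cat_cons.
  rewrite !(reduced_overlap w) => /andP[_ ->] /andP[_ red_yr].
  by rewrite /= neq_xy.
- rewrite size_cat /= size_cat addnS ltnS addnA.
  exact: leq_trans le_r (leq_addl _ _).
rewrite size_cat size_rev /= size_cat addnS addnA => -[eq_size].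
have : size Z + size Y == 0 by rewrite -leqn0 -(leq_add2r (size r)) eq_size.
rewrite addn_eq0 => /andP[/nilP Z0 /nilP Y0].
have r0 : size r = size L by rewrite -eq_size Z0 Y0.
have := tight_r r0; rewrite /= => /andP[/nilP q0 ->]; rewrite q0 andbT.
move: eq_q eq_u; rewrite Z0 Y0 cats1 /center_word q0 cats0.
by move=> /rcons_inj[<- _] ->.
Qed.

End FreeCoxeter.

(** * Hurwitz moves at adjacent entries *)

Section Orbit.
Variables (G : groupType) (n : nat).
Implicit Types h k : n.-tuple G.

Lemma hurwitz_orbit_act (b : braid n) h k :
  hurwitz_orbit h (hurwitz_act b k) -> hurwitz_orbit h k.
Proof.
case=> c eq_bk; exists (b^-1 * c).
by rewrite hurwitz_actM -eq_bk -hurwitz_actM mulVg hurwitz_act1.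
Qed.

Lemma hurwitz_sigma_split h (A B : seq G) x y : h = A ++ x :: y :: B :> seq G ->
  exists i : 'I_n.-1,
    hurwitz_sigma i h = A ++ lconj y x :: x :: B :> seq G.
Proof.
move=> eq_h; have sz : size A + (size B).+2 = n.
  by rewrite -(size_tuple h) eq_h size_cat.
have lt_A : size A < n.-1 by rewrite -sz !addnS ltnS leq_addr.
exists (Ordinal lt_A); apply: (@eq_from_nth _ 1).
  by rewrite size_tuple size_cat.
move=> k; rewrite size_tuple => lt_k.
rewrite -[k]/(val (Ordinal lt_k)) -tnth_nth tnth_mktuple -!val_eqE /=.
rewrite !(tnth_nth 1) eq_h /= !nth_cat ltnn subnn /= ltnNge leqnSn /= subSnn /=.
case: ltngtP => [lt_kA|lt_Ak|->]; last by rewrite subnn.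
  by rewrite ltn_eqF // ltnW.
rewrite -(subnKC lt_Ak) addSnnS addKn.
case: (k - (size A).+1) => [|m]; first by rewrite addn1 eqxx.
by rewrite gtn_eqF // !addnS !ltnS leq_addr.
Qed.

(** Read from k to h, this is the inverse move, so that both directions of the
    descent are covered by the positive generators. *)
Lemma hurwitz_orbit_adjacent h0 h k (A B : seq G) x y :
    h = A ++ x :: y :: B :> seq G -> k = A ++ lconj y x :: x :: B :> seq G ->
  hurwitz_orbit h0 k <-> hurwitz_orbit h0 h.
Proof.
move=> eq_h eq_k; have [i eq_i] := hurwitz_sigma_split eq_h.
have -> : k = hurwitz_act (braid_gen i) h.
  by apply: val_inj; rewrite hurwitz_act_gen [LHS]eq_k.
split=> [|[b ->]]; first exact: hurwitz_orbit_act.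
by exists (braid_gen i * b); rewrite hurwitz_actM.
Qed.

End Orbit.

(** * Descent *)

Section Induction.
Variable n : nat.
Implicit Types (L : seq (seq 'I_n * 'I_n)).

Definition weight L := sumn [seq size p.1 | p <- L].

(** The reduced word of the product has length at least size L, with equality
    only if all the conjugating words are empty, and it is enum 'I_n. *)
Lemma separated_standard L :
    size L = n -> uniq [seq p.2 | p <- L] ->
    all (fun p => reduced (center_word p)) L -> sorted (@separated n) L ->
    \prod_(p <- L) refl p = \prod_(i < n) cox_gen i ->
  [seq refl p | p <- L] = [seq cox_gen i | i <- enum 'I_n].
Proof.
case: L => [|p L] sz_L uniq_L red_L sep_L prod_L.
  by rewrite /= (size0nil (_ : size (enum 'I_n) = 0)) // size_enum_ord -sz_L.
have [r [prod_r red_r le_r tight_r]] := separated_prod red_L sep_L.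
have wprod_enum : wprod (enum 'I_n) = \prod_(i < n) cox_gen i.
  by rewrite /wprod enumT.
have red_enum : reduced (enum 'I_n) by apply/uniq_reduced/enum_uniq.
have eq_w : center_word p ++ r = enum 'I_n.
  by apply: wprod_inj => //; rewrite -prod_r prod_L wprod_enum.
have tight_L : all (fun q => nilp q.1) (p :: L).
  apply/tight_r/eqP; rewrite eqn_leq le_r andbT -ltnS [X in _ < X]sz_L.
  rewrite -[X in _ <= X]size_enum_ord -eq_w size_cat size_rcons.
  by rewrite ltnS leq_addl.
have eq_refl : [seq refl q | q <- p :: L] = [seq cox_gen q.2 | q <- p :: L].
  apply/eq_in_map => -[u a] /(allP tight_L)/nilP /= ->.
  by rewrite /refl /lconj /wprod big_nil mul1g invg1 mulg1.
have eq_snd : [seq q.2 | q <- p :: L] = enum 'I_n.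
  apply: wprod_inj => //; first exact: uniq_reduced.
  rewrite wprod_enum -prod_L -[RHS](big_map _ xpredT id) eq_refl.
  by rewrite /wprod !big_map.
by rewrite eq_refl -eq_snd -map_comp.
Qed.

Lemma orbit_of_factorization L (h : n.-tuple (free_coxeter n)) :
    h = [seq refl p | p <- L] :> seq _ -> uniq [seq p.2 | p <- L] ->
    \prod_(p <- L) refl p = \prod_(i < n) cox_gen i ->
  hurwitz_orbit [tuple cox_gen i | i < n] h.
Proof.
have [m] := ubnP (weight L); elim: m => // m IHm in L h *.
rewrite ltnS => le_m eq_h uniq_L prod_L.
have sz_L : size L = n by rewrite -(size_map (@refl n)) -eq_h size_tuple.
have [red_L|/allPn[p Lp /refl_shorten[u eq_p lt_u]]] :=
    boolP (all (fun q => reduced (center_word q)) L); last first.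
  move: le_m eq_h uniq_L prod_L; case/splitPr: Lp => A B.
  rewrite /weight !map_cat sumn_cat /= big_cat big_cons /= eq_p.
  move=> le_m eq_h uniq_L prod_L.
  apply: (IHm (A ++ (u, p.2) :: B)); rewrite ?map_cat ?big_cat ?big_cons //.
  rewrite /weight map_cat sumn_cat /=; apply: leq_trans le_m.
  by rewrite ltn_add2l ltn_add2r.
have [sep_L|/not_sorted_split[A [p [q [B [eq_L]]]]]] :=
    boolP (sorted (@separated n) L).
  exists 1; rewrite hurwitz_act1; apply: val_inj => /=.
  by rewrite [LHS]eq_h separated_standard.
subst L; have neq_pq : p.2 != q.2.
  move: uniq_L; rewrite map_cat cat_uniq /= inE => /and4P[_ _].
  by rewrite negb_or => /andP[].
(* A Hurwitz move exchanges the two centers, keeps the product of the two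
   factors, and here lowers their total weight, so the induction applies. *)
have step p' q' : size p'.1 + size q'.1 < size p.1 + size q.1 ->
    p'.2 = q.2 -> q'.2 = p.2 -> refl p' * refl q' = refl p * refl q ->
  exists2 k : n.-tuple (free_coxeter n),
    k = [seq refl p0 | p0 <- A ++ p' :: q' :: B] :> seq _ &
    hurwitz_orbit [tuple cox_gen i | i < n] k.
  move=> lt_w p'2 q'2 eq_pq.
  have sz_k : size [seq refl p0 | p0 <- A ++ p' :: q' :: B] == n.
    by rewrite size_map -[X in _ == X]sz_L !size_cat.
  exists (Tuple sz_k) => //; apply: (IHm (A ++ p' :: q' :: B)) => //.
  - apply: leq_trans le_m; rewrite /weight !map_cat !sumn_cat /= !addnA.
    by rewrite -!addnA !(addnA (size _)) ltn_add2l ltn_add2r.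
  - rewrite -(perm_uniq (s1 := [seq p0.2 | p0 <- A ++ p :: q :: B])) //.
    rewrite !map_cat perm_cat2l /= p'2 q'2.
    exact: permEl (perm_catCA [:: p.2] [:: q.2] _).
  - rewrite -prod_L !big_cat; congr (_ * _); rewrite !big_cons /=.
    by rewrite (mulgA (refl p')) eq_pq -(mulgA (refl p)).
(* The positive move shortens q in the first case; in the second, h is the
   image under the positive move of the tuple in which p is shortened. *)
move=> /nandP[]; rewrite negbK => /prefix_center; rewrite 1?[q.2 == _]eq_sym.
- case=> // v eq_q; have conj_q := refl_conj eq_q.
  have [||||k eq_k] := step (p.1 ++ v, q.2) p => //.
  + by rewrite addnC ltn_add2l eq_q !size_cat size_rcons addSn.
  + by rewrite -conj_q lconj_mul.
  have eq_h' :
      h = map (@refl n) A ++ refl p :: refl q :: map (@refl n) B :> seq _.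
    by rewrite [LHS]eq_h map_cat.
  apply: (hurwitz_orbit_adjacent _ eq_h' _).1.
  by rewrite [LHS]eq_k map_cat /= conj_q.
- case=> // v eq_p; have conj_p := refl_conj eq_p.
  have [||||k eq_k] := step q (q.1 ++ v, p.2) => //.
  + by rewrite addnC ltn_add2r eq_p !size_cat size_rcons addSn.
  + by rewrite -conj_p -lconj_mul lconj_reflK.
  rewrite map_cat /= in eq_k.
  apply: (hurwitz_orbit_adjacent _ eq_k _).2.
  by rewrite [LHS]eq_h map_cat /= -conj_p lconj_reflK.
Qed.

End Induction.

Theorem proposition2p2 (n : nat) (tau : 'S_n) (f : 'I_n -> free_coxeter n) :
  \prod_(i < n) lconj (cox_gen (tau i)) (f i) = \prod_(i < n) cox_gen i ->
  hurwitz_orbit [tuple cox_gen i | i < n]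
                [tuple lconj (cox_gen (tau i)) (f i) | i < n].
Proof.
move=> prod_f; have [u eq_u] := fin_all_exists (fun i => wprod_surj (f i)).
have eq_f i : refl (u i, tau i) = lconj (cox_gen (tau i)) (f i).
  by rewrite /refl /= -eq_u.
apply: (orbit_of_factorization (L := [seq (u i, tau i) | i <- enum 'I_n])).
- by rewrite /= -map_comp; apply: eq_map => i; rewrite /= eq_f.
- by rewrite -map_comp map_inj_uniq ?enum_uniq //; exact: perm_inj.
- by rewrite big_map enumT -prod_f; apply: eq_bigr.
Qed.
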